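(* Let $G$ be a simple connected graph with $p$ vertices and $q$ edges, let $k$ and $n$ be positive integers, and let $t\in\{n-1,n\}$. If the graphs $S(G)_k$ and $S(G)_t^n$ have the same order, then $S(G)_k$ and $S(G)_t^n$ are Randić equienergetic.
   Context: The Randić matrix $R(G)$ of a graph $G$ has $(i,j)$ entry $1/\sqrt{d_id_j}$ if $v_i,v_j$ are adjacent ($d_i$ is the degree of $v_i$), and $0$ otherwise. The Randić energy $\varepsilon_R(G)$ is the sum of the absolute values of the eigenvalues of $R(G)$ (with multiplicity). Two non-isomorphic graphs of the same order are Randić equienergetic if they have the same Randić energy. The subdivision graph $S(G)$ is obtained by inserting a new vertex into every edge of $G$; its vertex set is identified with $V(G)\cup E(G)$, with $v\in V(G)$ adjacent to $e\in E(G)$ iff $v$ is an endpoint of $e$. $S(G)_k$ ($k$ a positive integer): for every edge $e_i$ of $G$ introduce a set of $k$ new isolated vertices, make each of them adjacent to the two endpoints of $e_i$, and then remove all the original edges of $G$. It has $p+kq$ vertices. $S(G)_t^n$ ($n$ a positive integer, $t=n$ or $t=n-1$): start with $S(G)$. For each $v_j\in V(G)$ introduce $n$ new isolated vertices and join each to all neighbors of $v_j$ in $S(G)$. Then, for each vertex $e_j\in E(G)$ of $S(G)$, introduce $t$ new isolated vertices and join each to all neighbors of $e_j$ in the graph obtained so far (including the newly added copies of vertices of $G$). It has $(n+1)p+(t+1)q$ vertices and $2(t+1)(n+1)q$ edges.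
   Formalization: Equal Randić energy is proved in all cases; non-isomorphism is claimed except when G is a cycle with n=1, t=0, or G=K_2 with t=1, where the two graphs of equal order are in fact isomorphic, so the literal claim fails. *)

(* Defs.v *)
From HB Require Import structures.
From mathcomp Require Import all_boot all_order all_algebra.
From mathcomp Require Import polyrcf.
Set Implicit Arguments.
Unset Strict Implicit.
Unset Printing Implicit Defensive.
Import Order.TTheory GRing.Theory Num.Theory.
Local Open Scope ring_scope.

Record sgraph := SGraph {
  vertex :> finType;
  adj : rel vertex;
  adj_sym : symmetric adj;
  adj_irr : irreflexive adj
}.

Definition deg (G : sgraph) (v : G) : nat := #|[set w | adj v w]|.

(* The graph with no vertex is not connected. *)
Definition connected_graph (G : sgraph) : Prop :=
  (0 < #|G|)%N /\ forall v w : G, connect (@adj G) v w.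

Definition graph_iso (G H : sgraph) : Prop :=
  exists2 f : G -> H, bijective f & forall v w, adj (f v) (f w) = adj v w.

Definition edges (G : sgraph) : {set {set G}} :=
  [set [set p.1; p.2] | p : G * G & adj p.1 p.2].

Definition edge (G : sgraph) : finType := {e : {set G} | e \in edges G}.

Section Subdivision.
Variable G : sgraph.

Definition subdiv_rel : rel (G + edge G)%type := fun x y =>
  match x, y with
  | inl v, inr e => v \in val e
  | inr e, inl v => v \in val e
  | _, _ => false
  end.

Fact subdiv_sym : symmetric subdiv_rel.
Proof. by move=> [x|x] [y|y]. Qed.

Fact subdiv_irr : irreflexive subdiv_rel.
Proof. by case. Qed.

Definition subdivision : sgraph := SGraph subdiv_sym subdiv_irr.

End Subdivision.

(* S(G)_k: the vertices inr (e, i), i < k, are those introduced for e. *)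
Section SubdivisionK.
Variables (G : sgraph) (k : nat).

Definition subdivk_rel : rel (G + edge G * 'I_k)%type := fun x y =>
  match x, y with
  | inl v, inr ei => v \in val ei.1
  | inr ei, inl v => v \in val ei.1
  | _, _ => false
  end.

Fact subdivk_sym : symmetric subdivk_rel.
Proof. by move=> [x|x] [y|y]. Qed.

Fact subdivk_irr : irreflexive subdivk_rel.
Proof. by case. Qed.

Definition subdivisionk : sgraph := SGraph subdivk_sym subdivk_irr.

End SubdivisionK.

(* For each vertex a in A, m pairwise nonadjacent new vertices inr (a, i),
   i < m, joined to all the neighbours of a in H.  When A is independent in H,
   as in both uses below, treating the vertices of A one after the other or
   all at once gives the same graph. *)
Section AddCopies.
Variables (H : sgraph) (A : {set H}) (m : nat).

Definition copies_rel : rel (H + {a : H | a \in A} * 'I_m)%type := fun x y =>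
  match x, y with
  | inl v, inl w => adj v w
  | inl v, inr ai => adj v (val ai.1)
  | inr ai, inl v => adj v (val ai.1)
  | inr _, inr _ => false
  end.

Fact copies_sym : symmetric copies_rel.
Proof. by move=> [x|x] [y|y] //=; exact: adj_sym. Qed.

Fact copies_irr : irreflexive copies_rel.
Proof. by case=> [x|x] //=; exact: adj_irr. Qed.

Definition add_copies : sgraph := SGraph copies_sym copies_irr.

End AddCopies.

(* S(G)_t^n, in two steps; in the second, inl (inr e) is the vertex e of S(G)
   seen in the graph obtained after the first. *)
Definition subdivision_V (G : sgraph) (n : nat) : sgraph :=
  @add_copies (subdivision G) [set (inl v : subdivision G) | v in G] n.

Definition subdivision_VE (G : sgraph) (t n : nat) : sgraph :=
  @add_copies (subdivision_V G n)
    [set (inl (inr e) : subdivision_V G n) | e in edge G] t.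

Definition randic_matrix (R : rcfType) (G : sgraph) : 'M[R]_#|G| :=
  \matrix_(i, j)
    if adj (enum_val i) (enum_val j)
    then (Num.sqrt (deg (enum_val i) * deg (enum_val j))%:R)^-1 else 0.

(* rootsR lists the distinct roots in R.  The matrix is real symmetric, so its
   characteristic polynomial splits over R and no eigenvalue is missed. *)
Definition randic_energy (R : rcfType) (G : sgraph) : R :=
  let chi := char_poly (randic_matrix R G) in
  \sum_(x <- rootsR chi) `|x| *+ mup x chi.

Definition randic_equienergetic (R : rcfType) (G H : sgraph) : Prop :=
  [/\ ~ graph_iso G H, #|G| = #|H| & randic_energy R G = randic_energy R H].

(* Cases in which S(G)_k and S(G)_t^n are isomorphic as soon as they have the
   same order, hence not equienergetic in the sense above:
   - G a cycle (connected and 2-regular), n = 1, t = 0; then k = 2;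
   - G = K_2 and t = 1, so n is 1 or 2; then k = 2n + 2 and both graphs are
     K_{2,k}. *)
Definition iso_exception (G : sgraph) (n t : nat) : Prop :=
  ((forall v : G, deg v = 2%N) /\ n = 1%N /\ t = 0%N) \/
  (#|G| = 2%N /\ t = 1%N).

(* Main.v *)
Require Import Defs.
From mathcomp Require Import all_boot all_order all_algebra.
From mathcomp Require Import polyrcf zify ring.
Set Implicit Arguments.
Unset Strict Implicit.
Unset Printing Implicit Defensive.
Import Order.TTheory GRing.Theory Num.Theory.
Local Open Scope ring_scope.

(** Both graphs are blow-ups of the subdivision graph S(G): every vertex s is
replaced by an independent set of m(s) copies, where m takes one value a on
V(G) and one value b on E(G).  For S(G)_k the pair (a, b) is (1, k), for
S(G)_t^n it is (n + 1, t + 1).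

Energy.  For positive a and b, the Randić energy of such a blow-up H is that of
S(G).  Let A be the matrix with rows indexed by H, columns indexed by
S(G) and entry 1 / sqrt (m s) at (x, s) when x is a copy of s, 0 otherwise, so
that A^T A = 1.  A copy
of s has degree m'(s) d(s), where m' is m with a and b exchanged; adjacent s
and s' lie on different sides, so the degrees of adjacent copies multiply to
m(s) m(s') d(s) d(s').  This says exactly that the Randić matrix of H is
A R A^T, where R is that of S(G) ([blowup_energy]).  As A B and B A have the
same characteristic polynomial up to a power of X ([char_poly_mulmxC]), A R A^T
and R A^T A = R have the same nonzero eigenvalues, with multiplicities, and
zero eigenvalues do not contribute to the energy ([abs_root_sum_eq]).

Non-isomorphism.  Let p = |V(G)| and q = |E(G)|; equality of the orders excludes
q = 0.  A blow-up has degree sum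
4abq, so an isomorphism forces k = (n + 1)(t + 1), and equality of the orders
becomes p = (t + 1) q.  On the other hand all degrees of G are positive, so
p <= 2q and t <= 1.  If t = 1, then p = 2q, every degree is 1 and G is K_2.  If
t = 0, then n = 1 and k = 2; all degrees of S(G)_2 are even, while a vertex v
of G keeps its degree in S(G)_0^1, so the degrees of G are even and positive,
with sum 2p: they all equal 2 ([subdivision_iso_exception]). *)

(** * Characteristic polynomials and sums of absolute values of roots *)

(** Sylvester's identity.  Both sides are 'X^n times the determinant of the
block matrix with rows (X, A) and (B, 1), which multiplication by a block
triangular matrix reduces to either corner. *)
Lemma char_poly_mulmxC (R : comNzRingType) m n
    (A : 'M[R]_(m, n)) (B : 'M[R]_(n, m)) :
  'X^n * char_poly (A *m B) = 'X^m * char_poly (B *m A).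
Proof.
rewrite /char_poly /char_poly_mx !map_mxM.
set a := map_mx _ A; set b := map_mx _ B.
pose C := block_mx 'X%:M a b 1%:M.
have detC : \det C = \det ('X%:M - a *m b).
  rewrite -[LHS]mulr1.
  have <- : \det (block_mx 1%:M 0 (- b) 1%:M) = 1 :> {poly R}.
    by rewrite det_lblock !det1 mulr1.
  rewrite -det_mulmx mulmx_block !mulmx1 !mul1mx !mulmx0 !add0r mulmxN addrN.
  by rewrite det_ublock det1 mulr1.
have <- : 'X^n * \det C = 'X^m * \det ('X%:M - b *m a).
  have <- : \det (block_mx 1%:M 0 (- b) 'X%:M) = 'X^n :> {poly R}.
    by rewrite det_lblock det1 det_scalar mul1r.
  rewrite -det_mulmx mulmx_block !mul1mx !mul0mx !addr0 !mulmx1.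
  rewrite !mulNmx -scalar_mxC addNr [- _ + _]addrC.
  by rewrite det_ublock det_scalar.
by rewrite detC.
Qed.

Definition abs_root_sum (R : rcfType) (p : {poly R}) : R :=
  \sum_(x <- rootsR p) `|x| *+ mup x p.

Lemma uniq_rootsR (R : rcfType) (p : {poly R}) : uniq (rootsR p).
Proof. exact: uniq_roots. Qed.

Lemma mem_rootsR (R : rcfType) (p : {poly R}) : p != 0 -> rootsR p =i root p.
Proof. by move=> p0 x; rewrite -(roots_on_rootsR p0) // inE. Qed.

(** The root 0 contributes nothing, and away from 0 a power of X changes neither
the roots nor their multiplicities. *)
Lemma abs_root_sum_eq (R : rcfType) a b (p q : {poly R}) :
  p != 0 -> q != 0 -> 'X^a * p = 'X^b * q -> abs_root_sum p = abs_root_sum q.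
Proof.
move=> p0 q0 eqpq.
have nonzero r : abs_root_sum r = \sum_(x <- rootsR r | x != 0) `|x| *+ mup x r.
  rewrite big_mkcond; apply: eq_bigr => x _.
  by case: eqP => // ->; rewrite normr0 mul0rn.
have mupE x : x != 0 -> mup x p = mup x q.
  move=> x0; have nrX c : ~~ root 'X^c x.
    by rewrite /root hornerXn expf_neq0.
  by rewrite -(mupMr _ (nrX a)) eqpq mupMr.
have rootE x : x != 0 -> root p x = root q x.
  by move=> x0; rewrite !root_factor_theorem !XsubC_dvd // mupE.
rewrite !nonzero -big_filter -[RHS]big_filter.
rewrite (perm_big (filter (fun x => x != 0) (rootsR q))) /=; last first.
  apply: uniq_perm; rewrite ?filter_uniq ?uniq_rootsR // => x.
  rewrite !mem_filter !mem_rootsR //; case: eqP => //= /eqP x0.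
  exact: rootE.
by rewrite !big_filter; apply: eq_bigr => x x0; rewrite mupE.
Qed.

(** * Blow-ups *)

Section Blowup.

(** [H] arises from [S] by replacing each vertex [s] by [m s] copies; [pi] sends
a copy to its original.  Copies of one vertex are never adjacent, because
adjacency in [S] is irreflexive. *)
Definition blowup (H S : sgraph) (pi : H -> S) (m : S -> nat) : Prop :=
  (forall x y, adj x y = adj (pi x) (pi y)) /\
  (forall s, #|[set x | pi x == s]| = m s).

Variables (H S : sgraph) (pi : H -> S) (m : S -> nat).
Hypothesis pi_blowup : blowup pi m.

Lemma sum_blowup (P : pred S) (F : S -> nat) :
  (\sum_(x : H | P (pi x)) F (pi x) = \sum_(s | P s) m s * F s)%N.
Proof.
rewrite (partition_big pi P) //=; apply: eq_bigr => s Ps.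
rewrite (eq_bigl (fun x => x \in [set x | pi x == s])); last first.
  by move=> x; rewrite inE; case: eqP => [->|]; rewrite ?Ps ?andbF.
under eq_bigr => x do rewrite inE => /eqP ->.
by rewrite sum_nat_const pi_blowup.2.
Qed.

Lemma card_blowup : #|H| = (\sum_s m s)%N.
Proof.
rewrite -sum1_card (sum_blowup predT (fun=> 1%N)).
by apply: eq_bigr => s _; rewrite muln1.
Qed.

Lemma deg_blowup x : deg x = (\sum_(s | adj (pi x) s) m s)%N.
Proof.
rewrite /deg -sum1_card (eq_bigl (fun y => adj (pi x) (pi y))); last first.
  by move=> y; rewrite inE pi_blowup.1.
by rewrite (sum_blowup _ (fun=> 1%N)); apply: eq_bigr => s _; rewrite muln1.
Qed.

(** The degree hypothesis is what makes the Randić matrix of [H] equal to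
A R A^T for the column-orthonormal membership matrix A; it holds when [m] is
constant on each side of a bipartite [S]. *)
Lemma blowup_energy (R : rcfType) :
  (forall s, 0 < m s)%N ->
  (forall x y, adj x y ->
     deg x * deg y = (m (pi x) * m (pi y)) * (deg (pi x) * deg (pi y)))%N ->
  randic_energy R H = randic_energy R S.
Proof.
move=> m_gt0 degM.
pose c s : R := (Num.sqrt (m s)%:R)^-1.
pose A : 'M[R]_(#|H|, #|S|) := \matrix_(i, j)
  if enum_val j == pi (enum_val i) then c (enum_val j) else 0.
have mulA l (M : 'M[R]_(#|S|, l)) i j :
    (A *m M) i j = c (pi (enum_val i)) * M (enum_rank (pi (enum_val i))) j.
  rewrite mxE (bigD1 (enum_rank (pi (enum_val i)))) //= mxE enum_rankK eqxx.
  rewrite big1 ?addr0 // => j' /eqP ne; rewrite mxE.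
  by case: eqP => [e|]; rewrite ?mul0r //; case: ne; rewrite -e enum_valK.
have mulAt l (M : 'M[R]_(l, #|S|)) i j :
    (M *m A^T) i j = c (pi (enum_val j)) * M i (enum_rank (pi (enum_val j))).
  by rewrite -[M *m _]trmxK trmx_mul trmxK mxE mulA mxE.
have ATA : A^T *m A = 1%:M.
  apply/matrixP => j j'; rewrite !mxE.
  under eq_bigr => i _ do rewrite !mxE.
  case: eqP => [<-|ne]; last first.
    rewrite big1 // => i _.
    case: eqP => [e|]; rewrite ?mul0r //; case: eqP => [e'|]; rewrite ?mulr0 //.
    by case: ne; apply: enum_val_inj; rewrite e e'.
  pose a x := if enum_val j == pi x then c (enum_val j) else 0.
  rewrite -(big_enum_val (fun x => a x * a x)) /a.
  rewrite (bigID (mem [set x | pi x == enum_val j])) /=.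
  rewrite [X in _ + X]big1 ?addr0; last first.
    by move=> x; rewrite inE eq_sym => /negPf ->; rewrite mul0r.
  under eq_bigr => x do rewrite inE eq_sym => ->.
  rewrite sumr_const pi_blowup.2 /c -invfM -expr2 sqr_sqrtr ?ler0n //.
  by rewrite -[_ *+ _]mulr_natl mulfV // pnatr_eq0 -lt0n.
have RE : randic_matrix R H = A *m (randic_matrix R S *m A^T).
  apply/matrixP => i j; rewrite mulA mulAt.
  rewrite !mxE !enum_rankK pi_blowup.1.
  case: ifP => [Aij|]; last by rewrite !mulr0.
  rewrite degM ?pi_blowup.1 // /c -!invfM; congr (_^-1).
  by rewrite -mulnA !(natrM _ (m _)) !sqrtrM ?ler0n.
apply: (@abs_root_sum_eq _ #|S| #|H|).
- exact/monic_neq0/char_poly_monic.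
- exact/monic_neq0/char_poly_monic.
by rewrite RE char_poly_mulmxC -mulmxA ATA mulmx1.
Qed.

End Blowup.

(** A blow-up of a blow-up is a blow-up of the original graph provided that
copies of the same vertex are copied the same number of times. *)
Lemma blowup_comp (H2 H1 S : sgraph) (pi2 : H2 -> H1) (pi1 : H1 -> S)
    (m2 : H1 -> nat) (m1 : S -> nat) (m m' : S -> nat) :
  blowup pi2 m2 -> blowup pi1 m1 -> (forall h, m2 h = m' (pi1 h)) ->
  (forall s, m s = m1 s * m' s)%N -> blowup (pi1 \o pi2) m.
Proof.
move=> b2 b1 m2E mE; split=> [x y|s] /=; first by rewrite b2.1 b1.1.
rewrite -sum1_card (eq_bigl (fun x => pi1 (pi2 x) == s)); last first.
  by move=> x; rewrite inE.
rewrite (sum_blowup b2 (fun h => pi1 h == s) (fun=> 1%N)) mE.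
rewrite -b1.2 -sum_nat_const.
apply: eq_big => [h|h /eqP <-]; first by rewrite inE.
by rewrite muln1 m2E.
Qed.

Lemma sum_fst_eq (T : finType) m (a : T) :
  (\sum_(x : T * 'I_m | x.1 == a) 1 = m)%N.
Proof.
under eq_bigl => x do rewrite -[_ == _]andbT.
rewrite -(pair_big (pred1 a) predT (fun _ _ => 1%N)) /=.
by rewrite big_pred1_eq sum1_card card_ord.
Qed.

Section Copies.
Variables (H : sgraph) (A : {set H}) (m : nat).

Definition copies_proj (x : add_copies A m) : H :=
  match x with inl v => v | inr ai => val ai.1 end.

(** Independence of [A] is needed because two new vertices are never adjacent. *)
Lemma copies_blowup :
  {in A &, forall a b, adj a b = false} ->
  blowup copies_proj (fun h => if h \in A then m.+1 else 1%N).
Proof.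
move=> indepA; split=> [[v|[a i]] [w|[b j]] //=|h].
- exact: adj_sym.
- by rewrite indepA ?(valP a) ?(valP b).
rewrite -sum1_card big_sumType /=.
rewrite (eq_bigl (pred1 h)) ?big_pred1_eq => [|v]; last by rewrite !inE.
case: ifPn => [hA|hA]; last first.
  rewrite big1 // => -[a i]; rewrite inE /= => /eqP e.
  by case/negP: hA; rewrite -e (valP a).
rewrite (eq_bigl (fun ai => ai.1 == Sub h hA :> {a : H | a \in A})).
  by rewrite sum_fst_eq.
by move=> [a i]; rewrite inE.
Qed.

End Copies.

(** * Blow-ups of the subdivision graph *)

Section SubdivisionBlowups.
Variable G : sgraph.

Definition side_mult (a b : nat) (s : subdivision G) : nat :=
  if s is inl _ then a else b.

Definition subdivk_proj k (x : subdivisionk G k) : subdivision G :=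
  match x with inl v => inl v | inr ei => inr ei.1 end.

Lemma subdivk_blowup k : blowup (@subdivk_proj k) (side_mult 1 k).
Proof.
split=> [[v|[e i]] [w|[f j]] //=|s].
rewrite -sum1_card big_sumType /=.
case: s => [v|e] /=.
  rewrite (eq_bigl (pred1 v)) ?big_pred1_eq => [|w]; last by rewrite !inE.
  by rewrite big1 // => ei; rewrite inE.
rewrite big1 ?add0n => [|v]; last by rewrite inE.
rewrite (eq_bigl (fun ei => ei.1 == e)) ?sum_fst_eq // => -[f i].
by rewrite inE.
Qed.

Definition subdivVE_proj t n : subdivision_VE G t n -> subdivision G :=
  @copies_proj (subdivision G) _ n \o @copies_proj (subdivision_V G n) _ t.

Lemma subdivVE_blowup t n : blowup (@subdivVE_proj t n) (side_mult n.+1 t.+1).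
Proof.
pose V := [set (inl v : subdivision G) | v in G].
pose pV := @copies_proj (subdivision G) V n.
(* The second step copies exactly the fibres of pV over E(G): none of the
   vertices added by the first step lies over an edge. *)
apply: (@blowup_comp _ _ _ _ pV _ _ _ (side_mult 1 t.+1)).
- by apply: copies_blowup => _ _ /imsetP[e _ ->] /imsetP[f _ ->].
- by apply: copies_blowup => _ _ /imsetP[e _ ->] /imsetP[f _ ->].
- case=> [[v|e]|[[s sA] i]] /=.
  + by case: ifP => // /imsetP[].
  + by rewrite imset_f.
  + by case/imsetP: (sA) => v _ sE; rewrite {2}sE; case: ifP => // /imsetP[].
- case=> [v|e] /=; first by rewrite imset_f // muln1.
  by case: ifP => [/imsetP[]//|_]; rewrite mul1n.
Qed.

(** The neighbours of a vertex lie on the other side, hence the exchange of [a]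
and [b]. *)
Lemma deg_side_blowup (H : sgraph) (pi : H -> subdivision G) a b x :
  blowup pi (side_mult a b) ->
  deg x = (side_mult b a (pi x) * deg (pi x))%N.
Proof.
move=> piB; rewrite (deg_blowup piB) mulnC /deg -sum_nat_const.
apply: eq_big => [s|]; first by rewrite inE.
by case: (pi x) => [v|e] [w|f].
Qed.

Lemma side_blowup_energy (R : rcfType) (H : sgraph)
    (pi : H -> subdivision G) a b :
  (0 < a)%N -> (0 < b)%N -> blowup pi (side_mult a b) ->
  randic_energy R H = randic_energy R (subdivision G).
Proof.
move=> a0 b0 piB; apply: (blowup_energy piB) => [[]//|x y].
rewrite piB.1 !(deg_side_blowup _ piB) mulnACA.
by case: (pi x) (pi y) => [v|e] [w|f] //= _; rewrite [(b * a)%N]mulnC.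
Qed.

(** In a simple graph the neighbours w of v correspond to the edges {v, w}. *)
Lemma deg_subdiv_vertex (v : G) : deg (inl v : subdivision G) = deg v.
Proof.
have edgeP w : adj v w -> [set v; w] \in edges G.
  by move=> vw; apply/imsetP; exists (v, w); rewrite ?inE.
rewrite /deg -sum1_card big_sumType /= big1 ?add0n => [|w]; last by rewrite inE.
rewrite (eq_bigl (fun e => e \in [set e : edge G | v \in val e])); last first.
  by move=> e; rewrite !inE.
rewrite sum1_card -(card_imset _ val_inj).
rewrite -(card_in_imset (f := fun w => [set v; w])); last first.
  move=> w w'; rewrite !inE => vw vw' eqe.
  have: w \in [set v; w'] by rewrite -eqe set22.
  rewrite !inE => /orP[/eqP e|/eqP//].
  by move: vw; rewrite e adj_irr.
congr #|pred_of_set _|; apply/setP => e; apply/imsetP/imsetP.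
- case=> f; rewrite inE => vf ->; case/imsetP: (valP f) => [[x y]] /=.
  rewrite ?inE /= => xy fE.
  move: vf; rewrite (fE : val f = _) !inE => /orP[] /eqP ->.
    by exists y; rewrite ?inE.
  by exists x; rewrite ?inE 1?adj_sym 1?setUC.
- case=> w; rewrite inE => vw ->.
  by exists (Sub [set v; w] (edgeP w vw)); rewrite ?inE /= ?inE ?eqxx.
Qed.

Lemma deg_subdiv_edge (e : edge G) : deg (inr e : subdivision G) = 2%N.
Proof.
rewrite /deg -sum1_card big_sumType /= [X in (_ + X)%N]big1 ?addn0;
  last by move=> f; rewrite inE.
rewrite (eq_bigl (fun v => v \in val e)); last by move=> v; rewrite !inE.
rewrite sum1_card; case/imsetP: (valP e) => [[x y]] /=; rewrite ?inE /= => xy ->.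
by rewrite cards2; case: eqP xy => // ->; rewrite adj_irr.
Qed.

(** Both sides count the edges of the subdivision graph. *)
Lemma handshake : (\sum_(v : G) deg v = 2 * #|edge G|)%N.
Proof.
under eq_bigr => v _ do rewrite -deg_subdiv_vertex.
transitivity (\sum_(v : G) \sum_(e : edge G | v \in val e) 1)%N.
  apply: eq_bigr => v _; rewrite /deg -sum1_card big_sumType /= big1 ?add0n;
    last by move=> w; rewrite inE.
  by apply: eq_bigl => e; rewrite inE.
rewrite (exchange_big_dep predT) //= mulnC -sum_nat_const.
apply: eq_bigr => e _; rewrite -(deg_subdiv_edge e).
rewrite [RHS]/deg -sum1_card big_sumType /= [X in (_ + X)%N]big1 ?addn0;
  last by move=> f; rewrite inE.
by apply: eq_bigl => v; rewrite inE.
Qed.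

Lemma card_side_blowup (H : sgraph) (pi : H -> subdivision G) a b :
  blowup pi (side_mult a b) -> #|H| = (#|G| * a + #|edge G| * b)%N.
Proof.
move=> piB; rewrite (card_blowup piB) big_sumType /=.
by rewrite !sum_nat_const.
Qed.

Lemma sum_deg_side_blowup (H : sgraph) (pi : H -> subdivision G) a b :
  blowup pi (side_mult a b) ->
  (\sum_(x : H) deg x = 4 * (a * b * #|edge G|))%N.
Proof.
move=> piB; under eq_bigr => x _ do rewrite (deg_side_blowup x piB).
rewrite (sum_blowup piB predT (fun s => side_mult b a s * deg s)%N).
rewrite big_sumType /=.
under eq_bigr => v _ do rewrite deg_subdiv_vertex mulnA.
under [X in (_ + X)%N]eq_bigr => e _ do rewrite deg_subdiv_edge mulnA.
rewrite -big_distrr /= handshake sum_nat_const.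
by pose q := #|edge G|; rewrite -!/(edge G) -[#|xpredT|]/q -/q; ring.
Qed.

End SubdivisionBlowups.

(** * The isomorphic cases *)

Lemma deg_iso (H1 H2 : sgraph) (f : H1 -> H2) x :
  bijective f -> (forall v w, adj (f v) (f w) = adj v w) -> deg (f x) = deg x.
Proof.
move=> [g fK gK] fadj; rewrite /deg -(card_imset _ (can_inj fK)).
congr #|pred_of_set _|; apply/setP => y; rewrite inE; apply/idP/imsetP.
  by move=> xy; exists (g y); rewrite ?inE ?gK // -fadj gK.
by case=> z; rewrite inE => xz ->; rewrite fadj.
Qed.

Lemma sum_deg_iso (H1 H2 : sgraph) :
  graph_iso H1 H2 -> (\sum_(x : H1) deg x = \sum_(y : H2) deg y)%N.
Proof.
case=> f bf fadj; rewrite (reindex f) /=; last exact: onW_bij.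
by apply: eq_bigr => x _; rewrite (deg_iso _ bf fadj).
Qed.

Lemma connected_deg_gt0 (G : sgraph) (v : G) :
  connected_graph G -> (1 < #|G|)%N -> (0 < deg v)%N.
Proof.
move=> [_ conn] G1.
have [w wv] : exists w, w != v.
  have /card_gt0P[w] : (0 < #|predC1 v|)%N.
    by have := cardC1 v; move: G1; case: #|G| => [|[]] // n _ ->.
  by rewrite !inE; exists w.
case/connectP: (conn v w) => -[|u p] /= e we; first by rewrite we eqxx in wv.
by apply/card_gt0P; exists u; rewrite inE; case/andP: e.
Qed.

(** The two ends of an edge have no other neighbour, hence form a component. *)
Lemma connected_1regular (G : sgraph) :
  connected_graph G -> (forall v : G, deg v = 1%N) -> #|G| = 2%N.
Proof.
move=> [/card_gt0P[v _] conn] deg1.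
have nbr (x : G) : exists y, adj x y /\ forall z, adj x z -> z = y.
  have /eqP/cards1P[y yE] := deg1 x; exists y; split.
    by have := set11 y; rewrite -yE inE.
  by move=> z xz; apply/set1P; rewrite -yE inE.
have [w [vw vuniq]] := nbr v.
have closedvw : closed (@adj G) (mem [set v; w]).
  apply: intro_closed => [|x y xy]; first exact/sym_connect_sym/adj_sym.
  rewrite !inE => /orP[] /eqP ex; subst x; first by
    rewrite (vuniq _ xy) eqxx orbT.
  have [u [_ wuniq]] := nbr w.
  by rewrite (wuniq _ xy) (wuniq v) ?eqxx // adj_sym.
have -> : #|G| = #|[set v; w]|.
  rewrite -cardsT; congr #|pred_of_set _|; apply/setP => x.
  by have := closed_connect closedvw (conn v x); rewrite !inE eqxx /= => <-.
by rewrite cards2; case: eqP vw => // ->; rewrite adj_irr.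
Qed.

Lemma sum_min_const (T : finType) (f : T -> nat) c :
  (forall x, c <= f x)%N -> (\sum_x f x = #|T| * c)%N -> forall x, f x = c.
Proof.
move=> cf sumE x.
have [_] := leqif_sum (fun (x : T) (_ : true) => leqif_eq (cf x)).
by rewrite sumE sum_nat_const eqxx => /esym/forallP/(_ x)/eqP.
Qed.

(** An isomorphism gives two equations, from the degree sums and from the orders;
the positivity of the degrees of G leaves only t = 0 and t = 1. *)
Lemma subdivision_iso_exception (G : sgraph) (k n t : nat) :
  connected_graph G -> (0 < n)%N -> t = n.-1 \/ t = n ->
  #|subdivisionk G k| = #|subdivision_VE G t n| ->
  graph_iso (subdivisionk G k) (subdivision_VE G t n) -> iso_exception G n t.
Proof.
move=> conn n0 ht hord iso.
have Bk := subdivk_blowup G k; have BVE := subdivVE_blowup G t n.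
have := sum_deg_iso iso.
rewrite (sum_deg_side_blowup Bk) (sum_deg_side_blowup BVE).
move: hord; rewrite (card_side_blowup Bk) (card_side_blowup BVE) => hord hsum.
have p0 := conn.1; have hs := handshake G.
(* Without edges G would have order p = (n + 1) p, with n and p positive. *)
have q0 : (0 < #|edge G|)%N by nia.
have kE : k = (n.+1 * t.+1)%N by nia.
have pE : #|G| = (t.+1 * #|edge G|)%N by nia.
have G1 : (1 < #|G|)%N.
  rewrite ltn_neqAle p0 andbT; apply/negP => /eqP p1.
  have /card_gt0P[e _] := q0; case/imsetP: (valP e) => [[x y]].
  rewrite ?inE /= => xy _.
  have /fintype1P[z zE] : #|G| == 1%N by rewrite -p1.
  by move: xy; rewrite (zE x) (zE y) adj_irr.
have deg0 v := connected_deg_gt0 v conn G1.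
have [t0|t1] := posnP t.
  have n1 : n = 1%N by lia.
  left; split=> // v.
  have deg2 (w : G) : (1 < deg w)%N.
    (* w has degree deg w in S(G)_0^1, and the degrees of S(G)_2 are even. *)
    have : ~~ odd (deg w).
      have [f bf fadj] := iso; have [g fK gK] := bf.
      pose y : subdivision_VE G t n := inl (inl (inl w)).
      have : deg y = deg w.
        by rewrite (deg_side_blowup _ BVE) /= deg_subdiv_vertex t0 mul1n.
      rewrite -(gK y) (deg_iso _ bf fadj) (deg_side_blowup _ Bk) => <-.
      case: (subdivk_proj _) => [u|e] /=.
        by rewrite kE n1 t0 /= oddM.
      by rewrite deg_subdiv_edge.
    by have := deg0 w; case: (deg w) => [|[]].
  by apply: sum_min_const deg2 _ v; rewrite hs pE t0 mul1n mulnC.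
have : (#|G| <= \sum_(u : G) deg u)%N.
  by rewrite -sum1_card; apply: leq_sum => u _; exact: deg0.
rewrite hs => le_p.
have te1 : t = 1%N by nia.
right; split=> //; apply: connected_1regular => // v.
by apply: sum_min_const deg0 _ v; rewrite hs pE te1 muln1.
Qed.

Theorem theorem3p11 (R : rcfType) (G : sgraph) (k n t : nat)
    (hG : connected_graph G) (hk : (0 < k)%N) (hn : (0 < n)%N)
    (ht : t = n.-1 \/ t = n)
    (hord : #|subdivisionk G k| = #|subdivision_VE G t n|) :
  randic_energy R (subdivisionk G k) = randic_energy R (subdivision_VE G t n) /\
  (~ iso_exception G n t ->
   randic_equienergetic R (subdivisionk G k) (subdivision_VE G t n)).
Proof.
have energyE :
    randic_energy R (subdivisionk G k) = randic_energy R (subdivision_VE G t n).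
  rewrite (side_blowup_energy R _ hk (subdivk_blowup G k)) //.
  by rewrite (side_blowup_energy R _ _ (subdivVE_blowup G t n)).
split=> // noexc; split=> // iso.
exact: noexc (subdivision_iso_exception hG hn ht hord iso).
Qed.
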